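(* Let $(X,\mathcal B,m,T)$ be a conservative, ergodic, measure preserving transformation which is weakly pointwise dual ergodic with return sequence $a(n)=a_n(T)$. If $\alpha(T)<\infty$, then there exist $M>1$ and $N:\mathbb N\to\mathbb N$ such that $$M^{-1}\,p\,a(n)\ \le\ a(pn)\ \le\ M\,p\,a(n)\qquad\text{for all integers } p>1 \text{ and all } n\ge N(p).$$
   Context: $(X,\mathcal B,m)$ is a (standard) $\sigma$-finite measure space. The transfer operator $\widehat T:L^1(m)\to L^1(m)$ is defined by $$\int_X \widehat T f\cdot g\,dm=\int_X f\cdot g\circ T\,dm\qquad (f\in L^1(m),\ g\in L^\infty(m)).$$ A conservative, ergodic, measure preserving transformation $(X,\mathcal B,m,T)$ is weakly pointwise dual ergodic if there exist $a(n)>0$ $(n\ge1)$ such that for each $f\in L^1(m)_+$ (nonnegative integrable functions), $$\frac1{a(n)}\sum_{k=0}^{n-1}\widehat T^kf\ \longrightarrow\ \int_Xf\,dm\ \text{ in measure (on sets of finite measure)},\qquad \varlimsup_{n\to\infty}\frac1{a(n)}\sum_{k=0}^{n-1}\widehat T^kf=\int_Xf\,dm\ \text{ a.e.}$$ The sequence $a(n)$ is then unique up to asymptotic equivalence, and is called the return sequence of $T$, denoted $a_n(T)$. For such $T$ there is a constant $\alpha(T)\in[1,\infty]$ such that for every $f\in L^1(m)_+$, $$\varlimsup_{n\to\infty}\frac1{a_n(T)}\sum_{k=0}^{n-1}f\circ T^k=\alpha(T)\int_Xf\,dm\quad\text{a.e.}$$ *)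

(* Defs.v *)
(* MathComp-Analysis *)
From HB Require Import structures.
From mathcomp Require Import all_boot all_order all_algebra.
From mathcomp Require Import all_classical all_reals all_analysis.

Set Implicit Arguments.
Unset Strict Implicit.
Unset Printing Implicit Defensive.

Import Order.TTheory GRing.Theory Num.Theory.
Import numFieldNormedType.Exports.

Local Open Scope classical_set_scope.
Local Open Scope ring_scope.

(* X is Borel isomorphic to a complete separable metric space. *)
Definition standard_borel (R : realType) d (X : measurableType d) : Prop :=
  exists (P : metricType R) (phi : X -> P),
    [/\ bijective phi,
        exists2 D : set P, countable D & dense D,
        forall F : set_system P, ProperFilter F -> cauchy F ->
          exists p : P, F --> p
      & @measurable d X = [set phi @^-1` B | B in <<s @open P >>] ].

Section Transformations.
Context (R : realType) d (X : measurableType d).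
Implicit Types (m : {measure set X -> \bar R}) (T : X -> X).

Definition measure_preserving m T : Prop :=
  measurable_fun setT T /\
  forall A : set X, measurable A -> m (T @^-1` A) = m A.

Definition wandering T (W : set X) : Prop :=
  measurable W /\ trivIset setT (fun n : nat => iter n T @^-1` W).

Definition conservative m T : Prop :=
  forall W : set X, wandering T W -> m W = 0%E.

Definition ergodic m T : Prop :=
  forall A : set X, measurable A -> T @^-1` A = A ->
    m A = 0%E \/ m (~` A) = 0%E.

(* Elements of L^1 and L^oo are represented by functions, so That f is only
   determined up to a null set. *)
Definition transfer_operator m T (That : (X -> R) -> (X -> R)) : Prop :=
  forall f : X -> R, f \in Lfun m 1%E ->
    That f \in Lfun m 1%E /\
    forall g : X -> R, g \in Lfun m +oo%E ->
      \int[m]_x (That f x * g x) = \int[m]_x (f x * g (T x)).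

Definition L1_nonneg m (f : X -> R) : Prop :=
  f \in Lfun m 1%E /\ forall x, 0 <= f x.

Definition cvg_in_measure m (F : nat -> X -> R) (G : X -> R) : Prop :=
  forall A : set X, measurable A -> (m A < +oo)%E ->
  forall e : R, 0 < e ->
    m (A `&` [set x | e <= `|F n x - G x|]) @[n --> \oo] --> 0%E.

Definition dual_average (That : (X -> R) -> (X -> R)) (a : nat -> R)
    (f : X -> R) (n : nat) (x : X) : R :=
  (a n)^-1 * \sum_(0 <= k < n) iter k That f x.

Definition birkhoff_average T (a : nat -> R)
    (f : X -> R) (n : nat) (x : X) : R :=
  (a n)^-1 * \sum_(0 <= k < n) f (iter k T x).

Definition return_sequence m (That : (X -> R) -> (X -> R)) (a : nat -> R)
    : Prop :=
  (forall n, (0 < n)%N -> 0 < a n) /\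
  forall f : X -> R, L1_nonneg m f ->
    cvg_in_measure m (dual_average That a f) (fun=> \int[m]_x f x) /\
    {ae m, forall x, limn_esup (fun n => (dual_average That a f n x)%:E) =
                     (\int[m]_x (f x)%:E)%E}.

Definition weakly_pointwise_dual_ergodic m (That : (X -> R) -> (X -> R))
    : Prop :=
  exists a : nat -> R, return_sequence m That a.

(* alpha is unique as soon as m is nonzero and sigma-finite. *)
Definition is_alpha m T (a : nat -> R) (alpha : \bar R) : Prop :=
  (1 <= alpha)%E /\
  forall f : X -> R, L1_nonneg m f ->
    {ae m, forall x, limn_esup (fun n => (birkhoff_average T a f n x)%:E) =
                     (alpha * \int[m]_x (f x)%:E)%E}.

End Transformations.

(* Main.v *)
Require Import Defs.
From HB Require Import structures.
From mathcomp Require Import all_boot all_order all_algebra.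
From mathcomp Require Import all_classical all_reals all_analysis.
From mathcomp Require Import measurable_realfun ess_sup_inf ring lra.

Import Order.TTheory GRing.Theory Num.Theory.
Import numFieldNormedType.Exports.

Local Open Scope classical_set_scope.
Local Open Scope ring_scope.

(** The two inequalities have different sources: the upper one is a maximum
    principle for the dual sums, the lower one a count of visits that rests on
    the finiteness of [alpha].

    Write [That] for the transfer operator. Finiteness of the two limsups lets
    one choose a set [A] of finite positive measure and a constant [c] such
    that, for every [n >= 1] and on the whole of [A], both the number of visits
    to [A] before time [n] and the dual sum of [That^k 1_A] over [k < n] are at
    most [c a(n)]; moreover the dual sum is at least [(3/4) m(A) a(n)] off a
    subset of [A] of small measure, by convergence in measure ([adapted],
    [exists_adapted]). Dual sums are integrated against indicator functions, so
    that they become the numbers [sum_(k < n) m(A `&` T^-k B)] ([occupation],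
    [occupation_dual]); this avoids all almost-everywhere statements about the
    operator, which is determined up to null sets only.

    Upper bound. A maximum principle ([occupation_maximum]) extends the
    inequality [occupation n B <= c a(n) m(B)] from [B] inside [A] to all
    measurable [B]. It may then be applied to each of the [p] time blocks of
    length [n], giving [occupation (p n) B <= p c a(n) m(B)]
    ([occupation_block]), and the convergence in measure at time [p n] compares
    this with [a(p n)]. The constant does not depend on [p].

    Lower bound. Count, for [x] in [A], the chains of [p] successive visits to
    [A] in which every gap is less than [n]. By duality each step multiplies
    the integral of this count by about [m(A) a(n)]; the exceptional sets do
    not matter because the counts are bounded by [(c a(n))^p]
    ([integral_chainsS], [integral_chains_lb]). So some [x] in [A] has at least
    [(m(A) a(n) / 4)^p] chains. But a chain of [p] gaps is a multiset of visits
    before time [p n], so with [S] such visits there are at most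
    [C(S + p, p) <= (S + p)^p / p!] of them ([chains_le_bin]). As [p!] is at
    least [(p / e)^p], taking [p]-th roots gives [S + p >= p m(A) a(n) / (4 e)]:
    the factor [p] comes from the factorial, and it survives the root with a
    constant independent of [p]. Finally [a(n)] tends to infinity by
    conservativity ([return_sequence_unbounded]), which absorbs the summand
    [p], and [S <= c a(p n)]. *)

(** * Counting chains of visits *)

Section Visits.
Context {X : Type} (T : X -> X) (A : set X).
Local Open Scope nat_scope.

Definition visits (n : nat) (x : X) : nat :=
  \sum_(0 <= k < n) (iter k T x \in A).

(** The number of sequences of gaps [k_1, ..., k_p < n] such that [x], [T^k_1 x], [T^(k_1 + k_2) x],
    ... all lie in [A]. Zero gaps are allowed, which costs the shift by [p] in
    [chains_le_bin] and makes [chains] an iterate of one positive operator. *)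
Fixpoint chains (n p : nat) (x : X) : nat :=
  if p is q.+1 then (x \in A) * \sum_(0 <= k < n) chains n q (iter k T x)
  else (x \in A).

Lemma visitsS n x : visits n.+1 x = (x \in A) + visits n (T x).
Proof.
rewrite /visits big_nat_recl//=; congr addn.
by apply: eq_bigr => k _; rewrite -iterSr.
Qed.

Lemma leq_visits x : {homo visits^~ x : i j / i <= j}.
Proof.
by move=> i j ij; rewrite /visits (big_cat_nat _ ij)//= leq_addr.
Qed.

(** A telescoping sum: a visit at time [k] decreases by one the number of visits
    still to come before time [N], and by Pascal's rule the binomial coefficient
    on the right then drops by exactly the summand on the left. *)
Lemma sum_visits_bin (N n p : nat) x : n <= N ->
  \sum_(0 <= k < n) (iter k T x \in A) * 'C(visits (N - k) (iter k T x) + p, p)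
  <= 'C(visits N x + p.+1, p.+1).
Proof.
elim: n N x => [|n IH] [|N] x// nN; try by rewrite big_geq.
rewrite big_nat_recl//= subn0.
under eq_bigr do rewrite subSS -iterS iterSr.
apply: leq_trans (leq_add (leqnn _) (IH _ _ nN)) _.
rewrite visitsS; case: (x \in A) => /=; last first.
  by rewrite mul0n !add0n.
by rewrite mul1n add1n !addSn binS !addnS addnC.
Qed.

Lemma chains_supp n p x : chains n p x = (x \in A) * chains n p x.
Proof. by case: p => [|p] /=; rewrite ?mulnA; case: (x \in A). Qed.

(** The partial sums of the gaps are nondecreasing visit times before [p n]; the
    right-hand side counts the multisets of at most [p] such times, and this form
    is the one that Pascal's rule reproduces in the induction on [p]. *)
Lemma chains_le_bin (n p : nat) x : chains n p x <= 'C(visits (p * n) x + p, p).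
Proof.
elim: p x => [|p IH] x /=; first by rewrite bin0 leq_b1.
apply: leq_trans (sum_visits_bin (p.+1 * n) n p x (leq_pmull _ _)) => //.
apply: (@leq_trans (\sum_(0 <= k < n) chains n p (iter k T x))).
  by case: (x \in A); rewrite ?mul1n.
rewrite big_nat [leqRHS]big_nat; apply: leq_sum => k /= kn.
rewrite chains_supp leq_mul2l; apply/orP; right; apply: leq_trans (IH _) _.
rewrite leq_bin2l// leq_add2r leq_visits//.
by rewrite mulSn -addnBAC ?leq_addl// ltnW.
Qed.

End Visits.

Lemma bin_le_exp (s p : nat) : ('C(s, p) * p`! <= s ^ p)%N.
Proof.
rewrite bin_ffact; elim: p s => [|p IH] [|s]; rewrite ?ffactn0//.
rewrite ffactSS expnS leq_mul2l; apply/orP; right.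
by apply: leq_trans (IH s) _; case: (p) => // q; rewrite leq_exp2r.
Qed.

(** One term of the exponential series at [p]. *)
Lemma exp_le_fact (R : realType) (p : nat) :
  p%:R ^+ p <= expR 1 ^+ p * p`!%:R :> R.
Proof.
case: p => [|p]; first by rewrite !expr0 mul1r.
rewrite -ler_pdivrMr ?ltr0n ?fact_gt0// -expRM_natl mulr1.
apply: le_trans (expR_ge1Dxn p (ler0n R p.+1)).
by rewrite lerDr.
Qed.

(** * Duality for sums along orbits *)

Section Duality.
Context {R : realType} {d : measure_display} {X : measurableType d}.
Context (m : {measure set X -> \bar R}) (T : X -> X).
Context (That : (X -> R) -> (X -> R)).

Lemma measurable_fun_iter k :
  measurable_fun setT T -> measurable_fun setT (iter k T).
Proof.
move=> mT; elim: k => [|k IH]; first exact: measurable_id.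
by rewrite (_ : iter k.+1 T = T \o iter k T)//; exact: measurableT_comp.
Qed.

Lemma measurable_iter_preimage k A :
  measurable_fun setT T -> measurable A -> measurable (iter k T @^-1` A).
Proof.
by move=> mT mA; rewrite -[_ @^-1` _]setTI; exact: measurable_fun_iter.
Qed.

Lemma measure_iter_preimage k A : measure_preserving m T -> measurable A ->
  m (iter k T @^-1` A) = m A.
Proof.
move=> hT mA; elim: k => [|k IH]//.
rewrite (_ : _ @^-1` _ = T @^-1` (iter k T @^-1` A)).
  by rewrite hT.2//; exact: (measurable_iter_preimage _ _ hT.1).
by apply/seteqP; split => x /=; rewrite -iterS iterSr.
Qed.

Lemma bounded_Lfun_oo (g : X -> R) (K : R) : measurable_fun setT g ->
  (forall x, `|g x| <= K) -> g \in Lfun m +oo%E.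
Proof.
move=> mg gK; rewrite inE; apply/andP; split; rewrite inE//=.
rewrite /finite_norm unlock; case: ifPn => // m0.
by apply: (@le_lt_trans _ _ K%:E); [exact: ess_sup_ler|exact: ltry].
Qed.

Lemma integrable_mul_bounded (f g : X -> R) (K : R) : f \in Lfun m 1%E ->
  measurable_fun setT g -> (forall x, `|g x| <= K) ->
  m.-integrable setT (EFin \o (fun x => f x * g x)).
Proof.
move=> /Lfun1_integrable fi mg gK.
apply: (@integrableMl _ _ _ m setT measurableT (EFin \o f) g) => //.
exists K; split => [|M KM x _]; first by rewrite num_real.
by apply: (le_trans (gK x)); exact: ltW.
Qed.

Lemma Lfun1_indic A : measurable A -> (m A < +oo)%E ->
  (\1_A : X -> R) \in Lfun m 1%E.
Proof.
move=> mA Aoo; apply/Lfun1_integrable/integrableP; split.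
  exact/measurable_EFinP.
under eq_integral do rewrite /= ger0_norm//.
by rewrite integral_indic// setIT.
Qed.

Lemma Lfun1_iter k f : transfer_operator m T That -> f \in Lfun m 1%E ->
  iter k That f \in Lfun m 1%E.
Proof. by move=> hThat fL; elim: k => // k IH; rewrite iterS (hThat _ IH).1. Qed.

Lemma Lfun1_sum_iter n f : transfer_operator m T That -> f \in Lfun m 1%E ->
  (fun x => \sum_(0 <= k < n) iter k That f x) \in Lfun m 1%E.
Proof.
move=> hThat fL; apply/Lfun1_integrable; rewrite (_ : _ \o _ =
  fun x => (\sum_(0 <= k < n) (EFin \o iter k That f) x)%E).
  by apply: integrable_sum => // k _; exact/Lfun1_integrable/Lfun1_iter.
by apply/funext => x /=; rewrite sumEFin.
Qed.

Lemma transfer_iter k (f g : X -> R) (K : R) : measurable_fun setT T ->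
  transfer_operator m T That -> f \in Lfun m 1%E ->
  measurable_fun setT g -> (forall x, `|g x| <= K) ->
  \int[m]_x (iter k That f x * g x) = \int[m]_x (f x * g (iter k T x)).
Proof.
move=> mT hThat fL; elim: k g => [|k IH] g mg gK//.
rewrite iterS (hThat _ (Lfun1_iter k _ hThat fL)).2; last exact: bounded_Lfun_oo gK.
by apply: (IH (g \o T)) => [|x]; [exact: measurableT_comp|exact: gK].
Qed.

(** Boundedness of [g] makes both sides integrable, and it puts [g] composed with
    the iterates of [T] in the domain of the duality. *)
Lemma transfer_sum n (f g : X -> R) (K : R) : measurable_fun setT T ->
  transfer_operator m T That -> f \in Lfun m 1%E ->
  measurable_fun setT g -> (forall x, `|g x| <= K) ->
  \int[m]_x ((\sum_(0 <= k < n) iter k That f x) * g x) =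
  \int[m]_x (f x * \sum_(0 <= k < n) g (iter k T x)).
Proof.
move=> mT hThat fL mg gK.
have sL j := Lfun1_sum_iter j f hThat fL.
have mgT k : measurable_fun setT (fun x => g (iter k T x)).
  by apply: measurableT_comp => //; exact: measurable_fun_iter.
have msg j : measurable_fun setT (fun x => \sum_(0 <= k < j) g (iter k T x)).
  exact: measurable_sum.
have sgK j x : `|\sum_(0 <= k < j) g (iter k T x)| <= j%:R * K.
  apply: le_trans (ler_norm_sum _ _ _) _.
  apply: le_trans (ler_sum _ (fun k _ => gK _)) _.
  by rewrite sumr_const_nat subn0 mulr_natl.
elim: n => [|n IH].
  by apply: eq_Rintegral => x _; rewrite !big_geq// mul0r mulr0.
under eq_Rintegral do rewrite big_nat_recr//= mulrDl.
under [RHS]eq_Rintegral do rewrite big_nat_recr//= mulrDr.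
rewrite !RintegralD ?IH ?(transfer_iter _ _ _ K)//.
- exact: integrable_mul_bounded (sgK n).
- exact: (integrable_mul_bounded _ _ K).
- exact: (integrable_mul_bounded _ _ K).
- by apply: (integrable_mul_bounded _ _ K) => //; exact: Lfun1_iter.
Qed.

End Duality.

(** * Expected occupation times *)

Section Occupation.
Context {R : realType} {d : measure_display} {X : measurableType d}.
Context (m : {measure set X -> \bar R}) (T : X -> X).
Local Open Scope ereal_scope.

(** As a function of [B] this is the measure with density the sum of
    [That^k 1_A] over [k < n]; see [occupation_dual]. *)
Definition occupation (A : set X) (n : nat) (B : set X) : \bar R :=
  \sum_(0 <= k < n) m (A `&` iter k T @^-1` B).

Lemma occupation_ge0 A n B : 0 <= occupation A n B.
Proof. exact: sume_ge0. Qed.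

Lemma le_occupation A B : {homo occupation A ^~ B : i j / (i <= j)%N >-> i <= j}.
Proof.
move=> i j ij; rewrite /occupation (big_cat_nat _ ij)//=.
by rewrite leeDl// sume_ge0.
Qed.

Hypothesis hT : measure_preserving m T.

Lemma occupation_measurable A B k : measurable A -> measurable B ->
  measurable (A `&` iter k T @^-1` B).
Proof.
by move=> mA mB; apply: measurableI => //; apply: measurable_iter_preimage => //; exact: hT.1.
Qed.

(** An orbit starting in [A] reaches [B `\` A] at positive times only, so one
    step can be taken off. *)
Lemma occupationS_out A n B : measurable A -> measurable B ->
  occupation A n.+1 B <=
  occupation A n.+1 (B `&` A) + occupation A n (T @^-1` (B `\` A)).
Proof.
move=> mA mB.
have mBA : measurable (B `\` A) by exact: measurableD.
have mBIA : measurable (B `&` A) by exact: measurableI.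
rewrite [occupation A n _](_ : _ = occupation A n.+1 (B `\` A)).
  rewrite -big_split/=; apply: lee_sum => k _.
  rewrite -measureU//; [|exact: occupation_measurable..|].
    apply: le_measure; rewrite ?inE; try exact: occupation_measurable.
      by apply: measurableU; exact: occupation_measurable.
    move=> x [Ax /= Bx]; have [ATx|ATx] := pselect (A (iter k T x)).
      by left.
    by right.
  by apply/seteqP; split=> // x /= [] [_ [_ ?]] [_ []].
rewrite /occupation big_nat_recl//= [X in m X](_ : _ = set0).
  by rewrite measure0 add0e.
by apply/seteqP; split => // x [Ax [_ /=]].
Qed.

(** Maximum principle: the density of [occupation A n] is bounded everywhere by
    its supremum over [A]. Outside [A] the value at time [j + 1] is an average of
    values at time [j], since [T] preserves [m]; hence induction on the time. *)
Lemma occupation_maximum A n (D : R) : measurable A -> (0 <= D)%R ->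
  (forall B, measurable B -> B `<=` A -> occupation A n B <= D%:E * m B) ->
  forall B, measurable B -> occupation A n B <= D%:E * m B.
Proof.
move=> mA D0 HA.
(* The bound on [A] is kept at the final time [n] while [j] grows, as
   [occupation] is nondecreasing in time. *)
suff H j : (j <= n)%N -> forall B, measurable B -> occupation A j B <= D%:E * m B.
  exact: H.
elim: j => [|j IH] jn B mB.
  by rewrite /occupation big_geq// mule_ge0.
have mBA : measurable (B `\` A) by exact: measurableD.
have mBIA : measurable (B `&` A) by exact: measurableI.
apply: (le_trans (occupationS_out _ _ _ mA mB)).
rewrite (measureDI m mB mA) ge0_muleDr// addeC; apply: leeD.
  apply: le_trans (IH (ltnW jn) _ _) _; last by rewrite hT.2.
  by rewrite -[_ @^-1` _]setTI; exact: hT.1.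
by apply: le_trans (le_occupation _ _ _ _ jn) _; exact: HA.
Qed.

(** The visits to [B] during the [j]-th block of length [n] are the visits to
    [T^(-j n) B] during the first one, and that set has the same measure. This
    is why the bound is needed for all [B] and not only inside [A]. *)
Lemma occupation_block A n p (D : R) : (0 <= D)%R ->
  (forall B, measurable B -> occupation A n B <= D%:E * m B) ->
  forall B, measurable B -> occupation A (p * n) B <= (p%:R * D)%:E * m B.
Proof.
move=> D0 HA; elim: p => [|p IH] B mB.
  by rewrite /occupation big_geq// mul0r mul0e.
rewrite /occupation mulSn (big_cat_nat _ (leq_addr (p * n) n))//=.
rewrite [X in _ + X](_ : _ = occupation A (p * n) (iter n T @^-1` B)).
  rewrite -natr1 mulrDl mul1r EFinD ge0_muleDl ?lee_fin ?mulr_ge0// addeC.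
  apply: leeD; last exact: HA.
  apply: le_trans (IH _ _) _; last by rewrite (measure_iter_preimage _ _ _ _ hT).
  by apply: measurable_iter_preimage => //; exact: hT.1.
rewrite -{1}[n]add0n big_addn addKn; apply: eq_bigr => k _; congr (m (_ `&` _)).
by apply/seteqP; split => x /=; rewrite addnC iterD.
Qed.

Context (That : (X -> R) -> (X -> R)).
Hypothesis hThat : transfer_operator m T That.

Lemma occupation_dual A n B : measurable A -> m A < +oo -> measurable B ->
  occupation A n B =
  (\int[m]_x ((\sum_(0 <= k < n) iter k That \1_A x) * \1_B x))%:E.
Proof.
move=> mA Aoo mB.
rewrite (transfer_sum m T That n _ _ 1 hT.1 hThat (Lfun1_indic m A mA Aoo)) //; last first.
  by move=> x; rewrite ger0_norm// indicE lern1 leq_b1.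
have E : occupation A n B =
    \int[m]_x (\1_A x * \sum_(0 <= k < n) \1_B (iter k T x))%:E.
  under eq_integral do rewrite mulr_sumr -sumEFin.
  rewrite ge0_integral_sum//; last first.
    move=> k; apply/measurable_EFinP/measurable_funM => //.
    apply: (measurableT_comp (measurable_indic _)) => //.
    by apply: measurable_fun_iter; exact: hT.1.
  apply: eq_bigr => k _.
  rewrite -[X in m X]setIT -integral_indic//; last exact: occupation_measurable.
  by apply: eq_integral => x _; rewrite indicI.
rewrite E /Rintegral fineK// -E ge0_fin_numE ?occupation_ge0//.
apply/lte_sum_pinfty => k _; apply: le_lt_trans Aoo.
by apply: le_measure; rewrite ?inE//; exact: occupation_measurable.
Qed.

End Occupation.

(** * Integrating chains of visits *)

Section Chains.
Context {R : realType} {d : measure_display} {X : measurableType d}.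
Context (m : {measure set X -> \bar R}) (T : X -> X).
Context (That : (X -> R) -> (X -> R)) (A : set X).
Hypothesis hT : measure_preserving m T.
Hypothesis hThat : transfer_operator m T That.
Hypotheses (mA : measurable A) (Aoo : (m A < +oo)%E).

Local Notation dual_sum n x := (\sum_(0 <= k < n) iter k That \1_A x).

Lemma EFin_mul_measure (b : R) (B : set X) : measurable B -> (m B < +oo)%E ->
  (b%:E * m B)%E = (\int[m]_x (b * \1_B x))%:E.
Proof.
move=> mB Boo; rewrite RintegralZl//; last first.
  exact/Lfun1_integrable/Lfun1_indic.
by rewrite /Rintegral integral_indic// setIT EFinM fineK// ge0_fin_numE.
Qed.

Lemma Lfun1_dual_sum n : (fun x => dual_sum n x) \in Lfun m 1%E.
Proof. exact: (Lfun1_sum_iter _ _ _ _ _ hThat (Lfun1_indic m A mA Aoo)). Qed.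

Lemma integrable_dual_indic n (B : set X) : measurable B ->
  m.-integrable setT (EFin \o (fun x => dual_sum n x * \1_B x)).
Proof.
move=> mB; apply: (integrable_mul_bounded _ _ _ 1 (Lfun1_dual_sum n)) => // x.
by rewrite ger0_norm// indicE lern1 leq_b1.
Qed.

Lemma occupation_ub n (B : set X) (b : R) : measurable B -> (m B < +oo)%E ->
  (forall x, B x -> dual_sum n x <= b) ->
  (occupation m T A n B <= b%:E * m B)%E.
Proof.
move=> mB Boo Hb; rewrite (occupation_dual _ _ hT _ hThat)// EFin_mul_measure//.
rewrite lee_fin; apply: le_Rintegral => //.
- exact: integrable_dual_indic.
- have /Lfun1_integrable := Lfun1_indic m B mB Boo.
  by move=> /(integrableZl measurableT b); apply.
- move=> x _; rewrite indicE; case: (boolP (x \in B)) => xB; rewrite ?mulr0//.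
  by rewrite !mulr1 Hb//; exact: set_mem.
Qed.

Lemma occupation_lb n (B : set X) (b : R) : measurable B -> (m B < +oo)%E ->
  (forall x, B x -> b <= dual_sum n x) ->
  (b%:E * m B <= occupation m T A n B)%E.
Proof.
move=> mB Boo Hb; rewrite (occupation_dual _ _ hT _ hThat)// EFin_mul_measure//.
rewrite lee_fin; apply: le_Rintegral => //.
- have /Lfun1_integrable := Lfun1_indic m B mB Boo.
  by move=> /(integrableZl measurableT b); apply.
- exact: integrable_dual_indic.
- move=> x _; rewrite indicE; case: (boolP (x \in B)) => xB; rewrite ?mulr0//.
  by rewrite !mulr1 Hb//; exact: set_mem.
Qed.

Local Notation w n p x := ((chains T A n p x)%:R : R).

Lemma chainsS_natr n p x :
  w n p.+1 x = \1_A x * \sum_(0 <= k < n) w n p (iter k T x).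
Proof. by rewrite /= natrM natr_sum. Qed.

Lemma chains_indic n p x : w n p x = \1_A x * w n p x.
Proof. by rewrite {1}chains_supp natrM. Qed.

Lemma measurable_chains n p : measurable_fun setT (fun x => w n p x).
Proof.
elim: p => [|p IH]; first exact: measurable_indic.
rewrite (_ : (fun x => w n p.+1 x) =
  \1_A \* (fun x => \sum_(0 <= k < n) w n p (iter k T x))); last first.
  by apply/funext => x; rewrite chainsS_natr.
apply: measurable_funM => //; apply: measurable_sum => k.
by apply: (measurableT_comp IH); apply: measurable_fun_iter; exact: hT.1.
Qed.

(** Starting in [A] there are at most [G] choices for each gap. *)
Lemma chains_le_exp n p (G : R) : 0 <= G ->
  (forall x, A x -> (visits T A n x)%:R <= G) ->
  forall x, w n p x <= G ^+ p.
Proof.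
move=> G0 HG; elim: p => [|p IH] x; first by rewrite expr0 /= lern1 leq_b1.
rewrite chainsS_natr indicE; case: (boolP (x \in A)) => xA; last first.
  by rewrite mul0r exprn_ge0.
rewrite mul1r; apply: (@le_trans _ _ (\sum_(0 <= k < n) G ^+ p * \1_A (iter k T x))).
  apply: ler_sum => k _; rewrite chains_indic mulrC.
  by apply: ler_wpM2r => //; exact: IH.
rewrite -mulr_sumr exprSr; apply: ler_wpM2l; first exact: exprn_ge0.
by rewrite -natr_sum; apply: HG; exact: set_mem.
Qed.

Lemma integrable_supported (g : X -> R) (K : R) : measurable_fun setT g ->
  (forall x, `|g x| <= K) -> (forall x, g x = \1_A x * g x) ->
  m.-integrable setT (EFin \o g).
Proof.
move=> mg gK gA; rewrite (_ : g = fun x => \1_A x * g x); last exact/funext.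
by apply: (integrable_mul_bounded _ _ _ K) => //; exact: Lfun1_indic.
Qed.

(** Adding a visit in front of a chain is dual to multiplying by the dual sum, and
    that is at least [b] off [E]. The chains that start in [E] are discarded:
    there are at most [G^p] from each point. *)
Lemma integral_chainsS n p (b G : R) (E : set X) : 0 <= b -> 0 <= G ->
  (forall x, A x -> (visits T A n x)%:R <= G) ->
  measurable E -> E `<=` A ->
  (forall x, A x -> ~ E x -> b <= dual_sum n x) ->
  b * (\int[m]_x w n p x - G ^+ p * fine (m E)) <= \int[m]_x w n p.+1 x.
Proof.
move=> b0 G0 HG mE EA Hb.
have Eoo : (m E < +oo)%E.
  by apply: le_lt_trans Aoo; apply: le_measure; rewrite ?inE.
have mAE : measurable (A `\` E) by exact: measurableD.
have wG q x : `|w n q x| <= G ^+ q by rewrite ger0_norm//; exact: chains_le_exp.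
have iw q : m.-integrable setT (EFin \o (fun x => w n q x)).
  apply: (integrable_supported _ (G ^+ q)) => //; first exact: measurable_chains.
  exact: chains_indic.
pose h x := w n p x * \1_(A `\` E) x.
have mh : measurable_fun setT h.
  by apply: measurable_funM => //; exact: measurable_chains.
have h0 x : 0 <= h x by rewrite mulr_ge0.
have hw x : h x <= w n p x.
  by rewrite ler_piMr// indicE lern1 leq_b1.
have hG x : `|h x| <= G ^+ p.
  by rewrite ger0_norm// (le_trans (hw x))// chains_le_exp.
have hA x : h x = \1_A x * h x.
  by rewrite /h mulrA -chains_indic.
have ih : m.-integrable setT (EFin \o h).
  exact: (integrable_supported _ (G ^+ p)).
have iE : m.-integrable setT (EFin \o (fun x => G ^+ p * \1_E x)).
  have /Lfun1_integrable := Lfun1_indic m E mE Eoo.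
  by move=> /(integrableZl measurableT (G ^+ p)); apply.
have lower : \int[m]_x w n p x - G ^+ p * fine (m E) <= \int[m]_x h x.
  have -> : G ^+ p * fine (m E) = \int[m]_x (G ^+ p * \1_E x).
    have /(congr1 fine) := EFin_mul_measure (G ^+ p) E mE Eoo.
    by rewrite /= => <-; rewrite fineM// ge0_fin_numE.
  rewrite lerBlDr -RintegralD//; apply: le_Rintegral => //.
    by have := integrableD measurableT ih iE; apply.
  move=> x _; rewrite /h indicE [\1_E x]indicE.
  have [xE|xE] := boolP (x \in E).
    by rewrite mulr1 -[leLHS]add0r lerD ?mulr_ge0// chains_le_exp.
  rewrite mulr0 addr0; have [xA|xA] := boolP (x \in A).
    rewrite (_ : x \in A `\` E) ?mulr1//.
    by rewrite in_setD xA xE.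
  by rewrite chains_indic indicE (negbTE xA) !mul0r.
(* From here on only the chains starting outside [E] are kept. *)
apply: (le_trans (ler_wpM2l b0 lower)).
rewrite -RintegralZl//.
apply: (@le_trans _ _ (\int[m]_x (dual_sum n x * h x))).
  apply: le_Rintegral => //.
  - by move: ih => /(integrableZl measurableT b); apply.
  - exact: (integrable_mul_bounded _ _ _ (G ^+ p) (Lfun1_dual_sum n)).
  - move=> x _; rewrite /h; have [[xA xE]|nx] := pselect ((A `\` E) x).
      by rewrite ler_wpM2r// ?h0// Hb.
    by rewrite indicE memNset// !mulr0.
rewrite (transfer_sum m T That n _ _ (G ^+ p) hT.1 hThat (Lfun1_indic m A mA Aoo))//.
apply: le_Rintegral => //.
- apply: (integrable_mul_bounded _ _ _ (n%:R * G ^+ p)).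
  + exact: Lfun1_indic.
  + apply: measurable_sum => k.
    by apply: (measurableT_comp mh); apply: measurable_fun_iter; exact: hT.1.
  + move=> x; apply: le_trans (ler_norm_sum _ _ _) _.
    apply: le_trans (ler_sum _ (fun k _ => hG _)) _.
    by rewrite sumr_const_nat subn0 mulr_natl.
- move=> x _; rewrite chainsS_natr; apply: ler_wpM2l => //.
  by apply: ler_sum => k _; exact: hw.
Qed.

End Chains.

(** * Recurrence *)

Section Recurrence.
Context {R : realType} {d : measure_display} {X : measurableType d}.
Context (m : {measure set X -> \bar R}) (T : X -> X) (A : set X).

Definition last_visit : set X := A `\` \bigcup_k (iter k.+1 T @^-1` A).

(** An orbit makes its last visit to [A] at one time only. *)
Lemma wandering_last_visit : measurable_fun setT T -> measurable A ->
  wandering T last_visit.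
Proof.
move=> mT mA; split.
  apply: measurableD => //; apply: bigcup_measurable => k _.
  exact: measurable_iter_preimage.
apply/trivIsetP => i j _ _ ij; apply/seteqP; split => // x [/=].
wlog lij : i j {ij} / (i < j)%N => [H Wi Wj|].
  by move: ij; rewrite neq_ltn => /orP[/H|/H]; exact.
move=> [_ Wi] [Aj _]; apply: Wi; exists (j - i).-1 => //=.
by rewrite -iterS prednK ?subn_gt0// -iterD subnK// ltnW.
Qed.

(** By conservativity, the points whose orbit has a last visit to [A] form a null
    set: it is the union of the preimages of a wandering set. *)
Lemma infinitely_many_visits : measure_preserving m T -> conservative m T ->
  measurable A -> (0 < m A)%E ->
  exists2 x, A x & forall L, exists n, (L <= visits T A n x)%N.
Proof.
move=> hT hcons mA A0.
have W0 := hcons _ (wandering_last_visit hT.1 mA).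
have mW : measurable last_visit := (wandering_last_visit hT.1 mA).1.
pose Q := \bigcup_k (iter k T @^-1` last_visit).
have mWk k : measurable (iter k T @^-1` last_visit).
  by apply: measurable_iter_preimage => //; exact: hT.1.
have mQ : measurable Q by exact: bigcup_measurable.
have Q0 : m.-negligible Q.
  apply: negligible_bigcup => k; apply/negligibleP => //.
  exact: etrans (measure_iter_preimage _ _ _ _ hT mW) W0.
have /set0P[x [Ax Qx]] : A `\` Q != set0.
  apply/eqP; rewrite setD_eq0 => AQ; move: A0.
  by have /(negligibleP _ mA) -> := negligibleS AQ Q0; rewrite ltxx.
exists x => // L.
suff [n _ ?] : exists2 n, A (iter n T x) & (L <= visits T A n x)%N by exists n.
elim: L => [|L [n An Ln]]; first by exists 0%N.
have : ~ last_visit (iter n T x) by move=> W; apply: Qx; exists n.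
move=> /not_andP[//|/contrapT[k _ Ank]].
exists (k.+1 + n)%N; first by rewrite iterD.
apply: (@leq_trans (visits T A n.+1 x)); last first.
  by apply: leq_visits; rewrite addSn ltnS leq_addl.
by rewrite /visits big_nat_recr//= mem_set// addn1 ltnS.
Qed.

End Recurrence.

(** * Comparing the return sequence at n and pn *)

Section Comparison.
Context {R : realType} {d : measure_display} {X : measurableType d}.
Context (m : {measure set X -> \bar R}) (T : X -> X).
Context (That : (X -> R) -> (X -> R)) (a : nat -> R).

(** A set on which the limits defining [a] and [alpha] become inequalities. They
    hold at every positive time, so that they can be iterated along blocks; the last clause is convergence in measure, where the factor [3 / 4]
    leaves room for the loss on [E] in [integral_chains_lb]. *)
Record adapted (A : set X) (c : R) : Prop := Adapted {
  adapted_measurable : measurable A ;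
  adapted_gt0 : (0 < m A)%E ;
  adapted_lty : (m A < +oo)%E ;
  adapted_cst_gt0 : 0 < c ;
  adapted_visits : forall n x, (0 < n)%N -> A x ->
    (visits T A n x)%:R <= c * a n ;
  adapted_occupation : forall n B, (0 < n)%N -> measurable B -> B `<=` A ->
    (occupation m T A n B <= (c * a n)%:E * m B)%E ;
  adapted_dual : forall e : R, 0 < e -> exists N, forall n, (N <= n)%N ->
    exists E, [/\ measurable E, E `<=` A, fine (m E) <= e &
      forall x, A x -> ~ E x -> 3 / 4 * fine (m A) * a n <=
        \sum_(0 <= k < n) iter k That \1_A x] }.

Hypothesis hT : measure_preserving m T.
Hypothesis hThat : transfer_operator m T That.
Hypothesis hcons : conservative m T.
Hypothesis a_gt0 : forall n, (0 < n)%N -> 0 < a n.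
Context (A : set X) (c : R).
Hypothesis hA : adapted A c.

Let mu := fine (m A).
Let mA := adapted_measurable _ _ hA.
Let Aoo := adapted_lty _ _ hA.
Let c_gt0 := adapted_cst_gt0 _ _ hA.

Let mu_gt0 : 0 < mu.
Proof. by rewrite fine_gt0// (adapted_gt0 _ _ hA)/=. Qed.

(** The lower bound for the dual sum at time [p n] holds on a set of positive
    measure, where it meets the upper bound obtained from [p] blocks. *)
Lemma return_sequence_ub : exists N, forall p n, (0 < p)%N -> (0 < n)%N ->
  (N <= p * n)%N -> a (p * n)%N <= (4 / 3 * c / mu) * p%:R * a n.
Proof.
have [N HN] := adapted_dual _ _ hA (mu / 2) (divr_gt0 mu_gt0 (ltr0Sn R 1)).
exists N => p n p0 n0 /HN[E [mE EA muE HE]].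
pose B := A `\` E.
have mB : measurable B by exact: measurableD.
have Boo : (m B < +oo)%E.
  by apply: le_lt_trans Aoo; apply: le_measure; rewrite ?inE//; exact: subDsetl.
have Eoo : (m E < +oo)%E.
  by apply: le_lt_trans Aoo; apply: le_measure; rewrite ?inE.
have B_gt0 : 0 < fine (m B).
  rewrite measureD// (setIidr EA) fineB ?ge0_fin_numE// subr_gt0.
  by apply: le_lt_trans muE _; rewrite ltr_pdivrMr// ltr_pMr// ltr1n.
have Hlo : ((3 / 4 * mu * a (p * n)%N)%:E * m B <= occupation m T A (p * n) B)%E.
  apply: (occupation_lb _ _ _ _ hT hThat) => // x [Ax Ex]; exact: HE.
have ca0 : 0 <= c * a n by rewrite mulr_ge0 ?ltW ?a_gt0.
have Hup : (occupation m T A (p * n) B <= (p%:R * (c * a n))%:E * m B)%E.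
  apply: occupation_block => //; apply: occupation_maximum => // B' mB' B'A.
  exact: adapted_occupation.
have := le_trans Hlo Hup.
rewrite -(@fineK _ (m B)) ?ge0_fin_numE// -!EFinM lee_fin ler_pM2r// => H.
rewrite -(ler_pM2l (_ : 0 < 3 / 4 * mu)) ?mulr_gt0 ?divr_gt0//.
apply: le_trans H _; rewrite le_eqVlt; apply/orP; left; apply/eqP.
by field; rewrite gt_eqF.
Qed.

(** On [A] the sequence dominates the number of visits, which is unbounded along
    some orbit. *)
Lemma return_sequence_unbounded (L : R) :
  exists N, forall n, (N <= n)%N -> L <= a n.
Proof.
have [x Ax Hx] := infinitely_many_visits _ _ _ hT hcons mA (adapted_gt0 _ _ hA).
have [N HN] := Hx (Num.truncn (c * L)).+1.
exists N.+1 => n Nn; rewrite -(ler_pM2l c_gt0).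
apply: (@le_trans _ _ (visits T A n x)%:R); last first.
  by apply: (adapted_visits _ _ hA) => //; exact: leq_trans Nn.
have [cL|/ltW cL] := leP 0 (c * L); last exact: le_trans cL _.
apply/ltW/(lt_le_trans (truncnS_gt _)).
by rewrite ler_nat (leq_trans HN)// leq_visits// ltnW.
Qed.

(** Each step multiplies the integral by at least half of [mu * a n]: three
    quarters come from the dual sum, and two thirds remain once the discarded
    chains are taken off. *)
Lemma integral_chains_lb p : exists N, forall n, (N <= n)%N ->
  mu * (mu / 2 * a n) ^+ p <= \int[m]_x (chains T A n p x)%:R.
Proof.
elim: p => [|p [N HN]].
  exists 0%N => n _; rewrite expr0 mulr1 /= /Rintegral.
  by rewrite integral_indic// setIT.
(* Chosen so that the discarded part, [(c * a n) ^+ p * e], is one third of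
   the bound for [p]. *)
pose e := mu * (mu / 2) ^+ p / (3 * c ^+ p).
have e_gt0 : 0 < e by rewrite divr_gt0 ?mulr_gt0 ?exprn_gt0 ?divr_gt0.
have [N' HN'] := adapted_dual _ _ hA e e_gt0.
exists (maxn 1 (maxn N N')) => n; rewrite !geq_max => /and3P[n0 /HN Hp /HN'].
move=> [E [mE EA muE HE]].
have an0 := a_gt0 _ n0.
apply: le_trans (integral_chainsS _ _ _ _ hT hThat mA Aoo n p
  (3 / 4 * mu * a n) (c * a n) E _ _ _ mE EA HE).
- apply: (@le_trans _ _ (3 / 4 * mu * a n *
    (mu * (mu / 2 * a n) ^+ p - (c * a n) ^+ p * e))).
    rewrite le_eqVlt; apply/orP; left; apply/eqP.
    rewrite /e exprS ![(_ * a n) ^+ p]exprMn.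
    have : c ^+ p != 0 by rewrite expf_neq0// gt_eqF.
    move: (c ^+ p) ((mu / 2) ^+ p) (a n ^+ p) => u v w u0.
    by field.
  apply: ler_wpM2l; first by rewrite !mulr_ge0 ?invr_ge0// ltW.
  apply: lerB => //; apply: ler_wpM2l => //.
  by rewrite exprn_ge0// mulr_ge0// ltW.
- by rewrite !mulr_ge0 ?invr_ge0// ltW.
- by rewrite mulr_ge0 ?ltW.
- by move=> x; exact: (adapted_visits _ _ hA).
Qed.

(** A function on [A] is somewhere close to its mean; one half of the rate is given
    up in order to have a strict inequality. *)
Lemma many_chains p : (0 < p)%N -> exists N, forall n, (N <= n)%N ->
  exists2 x, A x & (mu / 4 * a n) ^+ p <= (chains T A n p x)%:R.
Proof.
move=> p0; have [N HN] := integral_chains_lb p.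
exists (maxn 1 N) => n; rewrite geq_max => /andP[n0 /HN Hp].
have an0 := a_gt0 _ n0.
apply: contrapT => noex.
have lt_chains x : A x -> (chains T A n p x)%:R <= (mu / 4 * a n) ^+ p.
  by move=> Ax; rewrite leNgt; apply/negP => /ltW ?; apply: noex; exists x.
have G0 : 0 <= (mu / 4 * a n) ^+ p by rewrite exprn_ge0// !mulr_ge0 ?invr_ge0// ltW.
have : \int[m]_x (chains T A n p x)%:R <= (mu / 4 * a n) ^+ p * mu.
  have /(congr1 fine) := EFin_mul_measure m ((mu / 4 * a n) ^+ p) A mA Aoo.
  rewrite fineM// ?ge0_fin_numE// => ->.
  have iA : m.-integrable setT (EFin \o (fun x => (mu / 4 * a n) ^+ p * \1_A x)).
    have /Lfun1_integrable := Lfun1_indic m A mA Aoo.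
    by move=> /(integrableZl measurableT ((mu / 4 * a n) ^+ p)); apply.
  have le_indic x : (chains T A n p x)%:R <= (mu / 4 * a n) ^+ p * \1_A x.
    rewrite chains_indic indicE; case: (boolP (x \in A)) => xA.
      by rewrite mul1r mulr1; apply/lt_chains/set_mem.
    by rewrite mul0r mulr0.
  apply: le_Rintegral => //.
  apply: (integrable_supported _ _ mA Aoo _ ((mu / 4 * a n) ^+ p)).
  - exact: (measurable_chains _ _ _ hT).
  - by move=> x; rewrite ger0_norm// (le_trans (le_indic x))// ler_piMr// indicE lern1 leq_b1.
  - exact: chains_indic.
apply/negP; rewrite -ltNge; apply: lt_le_trans Hp.
rewrite mulrC ltr_pM2l// ltrXn2r ?gtn_eqF//.
  by rewrite !mulr_ge0 ?invr_ge0// ltW.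
by rewrite ltr_pM2r// ltr_pM2l// ltf_pV2 ?posrE// ltr_nat.
Qed.

(** The pigeonhole step: many chains force many visits before time [p * n], and
    the visits are bounded by [c * a (p * n)]. *)
Lemma return_sequence_lb p : (0 < p)%N -> exists N, forall n, (N <= n)%N ->
  mu / (8 * expR 1 * c) * p%:R * a n <= a (p * n)%N.
Proof.
move=> p0; have [N1 HN1] := many_chains p p0.
have [N2 HN2] := return_sequence_unbounded (8 * expR 1 / mu).
exists (maxn 1 (maxn N1 N2)) => n; rewrite !geq_max => /and3P[n0 H1 /HN2 aL].
have {H1}[x Ax Hx] := HN1 _ H1.
have an0 := a_gt0 _ n0.
set S := visits T A (p * n) x.
have SC : S%:R <= c * a (p * n)%N.
  by apply: (adapted_visits _ _ hA) => //; rewrite muln_gt0 p0.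
have H : (p%:R * (mu / 4 * a n)) ^+ p <= (expR 1 * (S + p)%:R) ^+ p.
  rewrite [(p%:R * _) ^+ p]exprMn [(expR 1 * _) ^+ p]exprMn.
  apply: (@le_trans _ _ (expR 1 ^+ p * p`!%:R * (chains T A n p x)%:R)).
    apply: ler_pM => //; rewrite ?exp_le_fact ?exprn_ge0//.
    by rewrite !mulr_ge0 ?invr_ge0// ltW.
  rewrite -mulrA ler_pM2l ?exprn_gt0 ?expR_gt0// -natrM -natrX ler_nat.
  apply: leq_trans (bin_le_exp _ _).
  by rewrite mulnC leq_mul2r chains_le_bin orbT.
have {}H : p%:R * (mu / 4 * a n) <= expR 1 * (S + p)%:R.
  rewrite -(ler_pXn2r p0) ?nnegrE//.
  by rewrite !mulr_ge0 ?invr_ge0// ltW.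
(* The threshold on [n] is what makes the shift by [p] at most half of the
   bound. *)
have Hp : p%:R * expR 1 <= p%:R * (mu / 8 * a n).
  rewrite ler_wpM2l//; move: aL; rewrite ler_pdivrMr// => aL.
  lra.
have : p%:R * (mu / 8 * a n) <= expR 1 * (c * a (p * n)%N).
  apply: (@le_trans _ _ (expR 1 * S%:R)); last by rewrite ler_wpM2l ?expR_ge0.
  move: H; rewrite natrD mulrDr => H; lra.
have ec0 : 0 < expR 1 * c by rewrite mulr_gt0 ?expR_gt0.
rewrite [leRHS]mulrA -ler_pdivrMl//; apply: le_trans.
rewrite le_eqVlt; apply/orP; left; apply/eqP; field.
by rewrite !gt_eqF// expR_gt0.
Qed.

End Comparison.

(** * Choice of the reference set *)

Lemma limn_esup_bounded {R : realType} (u : nat -> R) :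
  (limn_esup (fun n => (u n)%:E) < +oo)%E -> exists K, forall n, u n <= K.
Proof.
move=> /ereal_inf_lt[_ [V [N _ NV] <-]] supV.
have [s Hs] : exists s : R, forall n, (N <= n)%N -> u n <= s.
  have ub n : (N <= n)%N -> ((u n)%:E <= ereal_sup [set (u x)%:E | x in V])%E.
    by move=> Nn; apply: ereal_sup_ubound; exists n => //; exact: NV.
  move: supV ub; case: (ereal_sup _) => [s| |]// _ ub.
    by exists s => n /ub; rewrite lee_fin.
  by have := ub _ (leqnn N).
exists (`|s| + \sum_(0 <= k < N) `|u k|) => n.
have [Nn|nN] := leqP N n.
  apply: le_trans (Hs _ Nn) _; apply: le_trans (ler_norm s) _.
  by rewrite lerDl sumr_ge0.
apply: le_trans (ler_norm _) _.
rewrite big_mkord (bigD1 (Ordinal nN))//= addrCA lerDl addr_ge0//.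
exact: sumr_ge0.
Qed.

Section ReferenceSet.
Context {R : realType} {d : measure_display} {X : measurableType d}.
Context (m : {sigma_finite_measure set X -> \bar R}) (T : X -> X).

Lemma exists_finite_gt0 : (0 < m setT)%E ->
  exists A, [/\ measurable A, (0 < m A)%E & (m A < +oo)%E].
Proof.
move=> hm; have [F FT HF] := sigma_finiteT m.
apply: contrapT => H; move: hm; rewrite FT.
have F0 i : m.-negligible (F i).
  apply/negligibleP; first exact: (HF i).1.
  apply/eqP; rewrite eq_le measure_ge0 andbT leNgt; apply/negP => Fi.
  by apply: H; exists (F i); split => //; [exact: (HF i).1|exact: (HF i).2].
have mF : measurable (\bigcup_i F i).
  by apply: bigcup_measurable => i _; exact: (HF i).1.
have /(negligibleP _ mF) -> : m.-negligible (\bigcup_i F i).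
  exact: negligible_bigcup.
by rewrite ltxx.
Qed.

Lemma measurable_fun_birkhoff_average (a : nat -> R) A n :
  measurable_fun setT T -> measurable A ->
  measurable_fun setT (birkhoff_average T a \1_A n).
Proof.
move=> mT mA; apply: measurable_funM => //; apply: measurable_sum => k.
apply: (measurableT_comp (measurable_indic _)) => //.
exact: measurable_fun_iter.
Qed.

Lemma measurable_fun_dual_average (That : (X -> R) -> X -> R) (a : nat -> R) A n :
  transfer_operator m T That -> measurable A -> (m A < +oo)%E ->
  measurable_fun setT (dual_average That a \1_A n).
Proof.
move=> hThat mA Aoo; apply: measurable_funM => //.
have /Lfun1_integrable/measurable_int/measurable_EFinP :=
  Lfun1_dual_sum m T That A hThat mA Aoo n.
exact.
Qed.

(** Start from any [A0] of finite positive measure. Both limsups for its indicator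
    are finite, so almost every point of [A0] has a finite bound on all its
    averages, and one integer bound [i] serves a subset [G i] of positive measure.
    The bounds pass from [A0] to [G i] because the indicator of the subset is
    smaller; convergence in measure is then used for [G i] itself. *)
Lemma exists_adapted (That : (X -> R) -> X -> R) (a : nat -> R) (alpha : \bar R) :
  (0 < m setT)%E -> measure_preserving m T -> transfer_operator m T That ->
  return_sequence m That a -> is_alpha m T a alpha -> (alpha < +oo)%E ->
  exists A c, adapted m T That a A c.
Proof.
move=> hm hT hThat [a_gt0 ha] [alpha1 halpha] alphaoo.
have [A0 [mA0 A0_gt0 A0oo]] := exists_finite_gt0 hm.
have L1 B : measurable B -> (m B < +oo)%E -> L1_nonneg m (\1_B : X -> R).
  by move=> mB Boo; split => [|x]; [exact: Lfun1_indic|].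
have int1 B : measurable B -> (\int[m]_x (\1_B x)%:E)%E = m B.
  by move=> mB; rewrite integral_indic// setIT.
pose G (i : nat) := A0 `&` \bigcap_n
  ([set x | dual_average That a \1_A0 n x <= i%:R] `&`
   [set x | birkhoff_average T a \1_A0 n x <= i%:R]).
have mG i : measurable (G i).
  apply: measurableI => //; apply: bigcap_measurable => // n _.
  apply: measurableI; rewrite -[X in measurable X]setTI;
    apply: measurable_fun_le => //.
    exact: measurable_fun_dual_average.
  exact: (measurable_fun_birkhoff_average _ _ _ hT.1).
have [i Gi] : exists i, (0 < m (G i))%E.
  apply: contrapT => noG.
  have G0 i : m.-negligible (G i).
    apply/negligibleP => //; apply/eqP; rewrite eq_le measure_ge0 andbT leNgt.
    by apply/negP => Gi; apply: noG; exists i.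
  have UG0 : m.-negligible (\bigcup_i G i) by exact: negligible_bigcup.
  have [_ hdual] := ha _ (L1 _ mA0 A0oo).
  have hbirk := halpha _ (L1 _ mA0 A0oo).
  have A00 := negligibleU (negligibleU hdual hbirk) UG0.
  move: A0_gt0; suff /(negligibleP _ mA0) -> : m.-negligible A0 by rewrite ltxx.
  apply: negligibleS A00 => x A0x.
  have [Gx|nGx] := pselect ((\bigcup_i G i) x); [by right|left].
  apply: contrapT => /not_orP[/contrapT Hd /contrapT Hb]; apply: nGx.
  have [|K1 HK1] := limn_esup_bounded (fun n => dual_average That a \1_A0 n x).
    by rewrite Hd int1.
  have [|K2 HK2] := limn_esup_bounded (fun n => birkhoff_average T a \1_A0 n x).
    rewrite Hb int1// lte_mul_pinfty//; first exact: le_trans alpha1.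
    by rewrite ge0_fin_numE//; exact: le_trans alpha1.
  have ub K : K <= `|K1| + `|K2| ->
      K <= (Num.truncn (`|K1| + `|K2|)).+1%:R.
    by move=> /le_trans; apply; apply/ltW/truncnS_gt.
  exists (Num.truncn (`|K1| + `|K2|)).+1 => //; split => // n _.
  split => /=; apply: ub.
    by apply: le_trans (HK1 n) _; apply: le_trans (ler_norm _) _; rewrite lerDl.
  by apply: le_trans (HK2 n) _; apply: le_trans (ler_norm _) _; rewrite lerDr.
have GA0 : G i `<=` A0 by move=> x [].
have Goo : (m (G i) < +oo)%E.
  by apply: le_lt_trans A0oo; apply: le_measure; rewrite ?inE.
have le_c n : (0 < n)%N -> i%:R * a n <= i.+1%:R * a n.
  by move=> n0; rewrite ler_pM2r ?a_gt0// ler_nat.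
exists (G i), i.+1%:R; split => //.
- move=> n x n0 [A0x /(_ n I)[_ /= birk]].
  apply: le_trans (le_c _ n0); rewrite -ler_pdivrMr ?a_gt0// mulrC.
  apply: le_trans birk; rewrite ler_pM2l ?invr_gt0 ?a_gt0//.
  rewrite natr_sum; apply: ler_sum => k _; rewrite indicE ler_nat.
  by case: (boolP (_ \in G i)) => // /set_mem/GA0/mem_set ->.
- move=> n B n0 mB BG.
  have Boo : (m B < +oo)%E.
    by apply: le_lt_trans Goo; apply: le_measure; rewrite ?inE.
  apply: (@le_trans _ _ (occupation m T A0 n B)).
    apply: lee_sum => k _; apply: le_measure; rewrite ?inE.
    + exact: (occupation_measurable m T hT).
    + exact: (occupation_measurable m T hT).
    + by apply: setSI.
  apply: (occupation_ub _ _ _ _ hT hThat) => // x /BG[_ /(_ n I)[/= dual _]].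
  apply: le_trans (le_c _ n0).
  by rewrite -ler_pdivrMr ?a_gt0// mulrC.
- move=> e e0; pose mu := fine (m (G i)).
  have mu_gt0 : 0 < mu by rewrite fine_gt0// Gi.
  have [+ _] := ha _ (L1 _ (mG i) Goo).
  move=> /(_ _ (mG i) Goo (mu / 4) (divr_gt0 mu_gt0 (ltr0Sn R 3))).
  move=> /fine_cvgP[_ /cvgr0_norm_lt/(_ e e0)[N _ HN]].
  exists (maxn 1 N) => n; rewrite geq_max => /andP[n0 /HN /= Hn].
  eexists; split; last 2 first.
  + exact/ltW/(le_lt_trans (ler_norm _) Hn).
  + move=> x Gx /= nE.
    have {nE} : `|dual_average That a \1_(G i) n x - mu| < mu / 4.
      rewrite ltNge; apply/negP => far; apply: nE; split => //=.
      by rewrite /Rintegral int1.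
    rewrite /dual_average ltr_norml => /andP[close _].
    rewrite -ler_pdivlMr ?a_gt0// [leRHS]mulrC -/mu.
    lra.
  + apply: measurable_fun_le => //.
    apply: measurableT_comp => //; apply: measurable_funB => //.
    apply: measurable_funTS; exact: measurable_fun_dual_average.
  + by move=> x [].
Qed.

End ReferenceSet.

Theorem theorem4 (R : realType) (d : measure_display) (X : measurableType d)
    (m : {sigma_finite_measure set X -> \bar R})
    (hstd : standard_borel R X) (hm : (0 < m setT)%E)
    (T : X -> X)
    (hT : measure_preserving m T) (hcons : conservative m T)
    (herg : ergodic m T)
    (That : (X -> R) -> (X -> R)) (hThat : transfer_operator m T That)
    (hwpde : weakly_pointwise_dual_ergodic m That)
    (a : nat -> R) (ha : return_sequence m That a)
    (alpha : \bar R) (halpha : is_alpha m T a alpha)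
    (hfin : (alpha < +oo)%E) :
  exists (M : R) (N : nat -> nat), 1 < M /\
    forall p n : nat, (1 < p)%N -> (N p <= n)%N ->
      M^-1 * p%:R * a n <= a (p * n)%N <= M * p%:R * a n.
Proof.
have [A [c hA]] := exists_adapted m T That a alpha hm hT hThat ha halpha hfin.
have a_gt0 := ha.1.
have [Nu Hu] := return_sequence_ub m T That a hT hThat a_gt0 A c hA.
have /choice[Nl Hl] : forall p, exists N, forall n, (0 < p)%N -> (N <= n)%N ->
    fine (m A) / (8 * expR 1 * c) * p%:R * a n <= a (p * n)%N.
  move=> p; case: (posnP p) => [->|p0]; first by exists 0%N.
  have [N HN] := return_sequence_lb m T That a hT hThat hcons a_gt0 A c hA p p0.
  by exists N => n _; exact: HN.
have c_gt0 := adapted_cst_gt0 _ _ _ _ _ _ hA.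
have mu_gt0 : 0 < fine (m A).
  by rewrite fine_gt0// (adapted_gt0 _ _ _ _ _ _ hA) (adapted_lty _ _ _ _ _ _ hA).
move: (Hu) (Hl); set U := 4 / 3 * c / _; set K := _ / (8 * _ * c) => {}Hu {}Hl.
have U_gt0 : 0 < U by rewrite !(divr_gt0, mulr_gt0).
have K_gt0 : 0 < K by rewrite !(divr_gt0, mulr_gt0, expR_gt0).
clearbody U K; pose M := 2 + U + K^-1.
have Ki_gt0 : 0 < K^-1 by rewrite invr_gt0.
have [M1 UM KM] : [/\ 1 < M, U <= M & K^-1 <= M] by rewrite /M; split; lra.
exists M, (fun p => maxn 1 (maxn Nu (Nl p))); split=> // p n p1.
rewrite !geq_max => /and3P[n0 Nun Nln].
have p0 : (0 < p)%N by exact: ltnW.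
have pan : 0 <= p%:R * a n by rewrite mulr_ge0// ltW// a_gt0.
apply/andP; split.
  apply: le_trans (Hl p n p0 Nln); rewrite -!mulrA; apply: ler_wpM2r => //.
  by rewrite -[leRHS]invrK lef_pV2 ?posrE ?invr_gt0// (lt_trans _ M1).
apply: (@le_trans _ _ (U * p%:R * a n)).
  by apply: Hu => //; apply: leq_trans Nun _; rewrite leq_pmull.
by rewrite -!mulrA; apply: ler_wpM2r.
Qed.
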